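(* Let $\bar Y_n$ be the out-degree of a node chosen uniformly at random from the inserted nodes $\{1,\dots,n\}$ of a random ordered increasing $k$-tree of size $n\ge1$. Then for $m\ge0$, \[ \mathbb{P}\{\bar Y_n=m\}=\frac{1}{n\binom{n-\frac{k}{k+1}}{n}}\sum_{\ell=0}^{m}\frac{\binom{m}{\ell}(-1)^{\ell}}{k(\ell+2)+1}\left(\binom{n+\frac{1}{k+1}}{n}-\binom{n-\frac{k(\ell+2)}{k+1}}{n}\right). \] As $n\to\infty$, $\bar Y_n$ converges in distribution to a discrete random variable $\bar Y$ with \[ \mathbb{P}\{\bar Y=m\}=p_m:=\frac{k+1}{k(m+1)\binom{m+2+\frac1k}{m+1}},\quad m\ge0, \] and $p_m\sim\frac{k+1}{k}\Gamma(2+\frac1k)\,m^{-2-\frac1k}$ as $m\to\infty$.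
   Context: Fix an integer $k\ge1$. An ordered increasing $k$-tree of size $n\ge0$ is built as follows. Start with the root-clique $K_0$: $k$ pairwise adjacent vertices labelled $0_1,\dots,0_k$ (the root nodes; each label $0_\ell$ has value $0$). For $j=1,\dots,n$ in turn, node $j$ is inserted by choosing a currently existing $k$-clique $K$ and attaching $j$ to it, i.e. adding edges from $j$ to all $k$ vertices of $K$; $j$ is then a child of $K$ and the vertices of $K$ are the parents of $j$. The $k$-cliques available for attachment are the root-clique and, for every previously inserted node $x$ attached to a clique $K'$, the $k$ cliques $\{x\}\cup(K'\setminus\{w\})$, $w\in K'$. The children of each $k$-clique are linearly ordered: if $K$ currently has $d^+(K)$ children, there are $d^+(K)+1$ positions at which the new child may be placed, and the choice of position is part of the structure. Thus there are $1+(k+1)(j-1)$ ways to insert node $j$, and distinct sequences of choices give distinct trees. A random ordered increasing $k$-tree of size $n$ is one chosen uniformly among all of them; equivalently, it is produced by the process in which node $n$ is attached to the clique $K$ with probability $\frac{d^+(K)+1}{1+(k+1)(n-1)}$ (and a uniformly random position among the $d^+(K)+1$). The out-degree of a node $u$ is the number of nodes having $u$ as a parent (for a root node this is its number of non-root neighbours). For real $x$ and integer $m\ge0$, $\binom{x}{m}=x(x-1)\cdots(x-m+1)/m!$, and $\binom{x}{m}=0$ for $m<0$. *)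

(* Defs.v *)
From Stdlib Require Import Reals Factorial.
From mathcomp Require Import all_boot.

Set Implicit Arguments.
Unset Strict Implicit.
Unset Printing Implicit Defensive.

(* A tree of size n is encoded by its insertion sequence
   t = [:: (c_1,p_1); ...; (c_n,p_n)] : node j is attached to clique
   number c_j, at position p_j among the (current number of children of
   c_j) + 1 possible positions.
   Clique numbering: the root clique is 0; node x (x >= 1) creates, in
   order w = 0..k-1, the cliques numbered 1 + k*(x-1) + w, namely
   {x} u (K' \ {w-th vertex of K'}) where K' is the clique x attached to.
   A clique is stored as the list of the values of its k vertices; the
   root nodes 0_1..0_k all have value 0. *)

Definition drop_at (T : Type) (w : nat) (s : seq T) : seq T :=
  take w s ++ drop w.+1 s.

Definition add_node (k : nat) (acc : seq (seq nat)) (jc : nat * nat)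
  : seq (seq nat) :=
  acc ++ [seq jc.1 :: drop_at w (nth [::] acc jc.2) | w <- iota 0 k].

Definition cliques (k : nat) (t : seq (nat * nat)) : seq (seq nat) :=
  foldl (add_node k) [:: nseq k 0] (zip (iota 1 (size t)) (unzip1 t)).

Definition parents (k : nat) (t : seq (nat * nat)) (j : nat) : seq nat :=
  nth [::] (cliques k t) (nth (0, 0) t j.-1).1.

Definition outdeg (k : nat) (t : seq (nat * nat)) (u : nat) : nat :=
  count (fun j => u \in parents k t j) (iota 1 (size t)).

Definition nchildren (t : seq (nat * nat)) (c : nat) : nat :=
  count (fun x => x.1 == c) t.

(* all ordered increasing k-trees of size n: node n+1 is inserted into
   one of the 1 + k*n existing cliques c, at one of nchildren t c + 1
   positions.  Each tree occurs exactly once. *)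
Fixpoint trees (k n : nat) : seq (seq (nat * nat)) :=
  match n with
  | 0 => [:: [::]]
  | n'.+1 =>
      flatten [seq flatten [seq [seq rcons t (c, p)
                                   | p <- iota 0 (nchildren t c).+1]
                             | c <- iota 0 (1 + k * n')]
              | t <- trees k n']
  end.

Definition count_outdeg (k n m : nat) : nat :=
  sumn [seq count (fun u => outdeg k t u == m) (iota 1 n) | t <- trees k n].

Local Open Scope R_scope.

Definition prob_Ybar (k n m : nat) : R :=
  INR (count_outdeg k n m) / (INR n * INR (size (trees k n))).

Fixpoint falling (x : R) (m : nat) : R :=
  match m with
  | O => 1
  | S m' => falling x m' * (x - INR m')
  end.

Definition gbinom (x : R) (m : nat) : R := falling x m / INR (Factorial.fact m).

Definition p_lim (k m : nat) : R :=
  (INR k + 1) /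
  (INR k * INR (m + 1) * gbinom (INR m + 2 + 1 / INR k) (m + 1)).

Definition exact_formula (k n m : nat) : R :=
  / (INR n * gbinom (INR n - INR k / (INR k + 1)) n) *
  sum_f_R0 (fun l =>
      INR 'C(m, l) * (-1) ^ l / (INR k * (INR l + 2) + 1) *
      (gbinom (INR n + 1 / (INR k + 1)) n
       - gbinom (INR n - INR k * (INR l + 2) / (INR k + 1)) n)) m.

(* Gamma(x) via Gauss's limit: Gamma x = lim n! n^x / (x (x+1) ... (x+n)) *)
Fixpoint rising (x : R) (m : nat) : R :=
  match m with
  | O => 1
  | S m' => rising x m' * (x + INR m')
  end.

Definition is_Gamma (x G : R) : Prop :=
  Un_cv (fun n => INR (Factorial.fact n) * Rpower (INR n) x / rising x (S n)) G.

(* Main.v *)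
Require Import Defs.
From Stdlib Require Import Reals Factorial Lra Lia.
From mathcomp Require Import all_boot zify.

(* A node of out-degree d lies in k + (k - 1) d cliques, which together have d
   children, so k (d + 1) of the 1 + (k + 1) n insertions of node n + 1 make it
   a child of that node, whatever the tree is.  Hence the number C(n, m) of
   pairs (tree of size n, node of out-degree m) satisfies
     C(n+1, m) = (1 + (k+1) n - k (m+1)) C(n, m) + k m C(n, m-1) + [m = 0] T(n+1)
   with T(n) the number of trees.  Writing C(n, .) as the alternating binomial
   transform of a sequence in l diagonalises this recurrence, because
   (m+1) 'C(m, l) - m 'C(m-1, l) = (l+1) 'C(m, l); each mode is then a
   difference of two rising factorials.  After division by n T(n) only one of
   the two survives as n grows, and the partial fraction expansion of
   m! / (x (x+1) ... (x+m)) at x = 2 + 1/k gives p_m.  The p_m telescope, and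
   their asymptotics is Gauss's limit for Gamma(x). *)

(** * Cliques and out-degrees along an insertion sequence *)

Lemma count_sum (T : Type) (a : pred T) (s : seq T) :
  count a s = \sum_(x <- s) a x.
Proof. by elim: s => [|x s IHs]; rewrite ?big_nil // big_cons -IHs. Qed.

(** Positions stay free here: cliques and out-degrees depend only on the clique numbers. *)
Inductive ktree (k : nat) : seq (nat * nat) -> Prop :=
| ktree_nil : ktree k [::]
| ktree_rcons t c p :
    ktree k t -> c < 1 + k * size t -> ktree k (rcons t (c, p)).

Lemma treesS k n :
  trees k n.+1 =
    flatten [seq flatten [seq [seq rcons t (c, p)
                                 | p <- iota 0 (nchildren t c).+1]
                           | c <- iota 0 (1 + k * n)]
            | t <- trees k n].
Proof. by []. Qed.

Lemma mem_trees k n t : t \in trees k n -> ktree k t /\ size t = n.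
Proof.
elim: n t => [|n IHn] t.
  by rewrite inE => /eqP ->; split=> //; constructor.
rewrite treesS => /flattenP [_ /mapP [t' /IHn [kt' szt'] ->]].
move=> /flattenP [_ /mapP [c cP ->]] /mapP [p _ ->].
rewrite size_rcons szt'; split=> //; constructor=> //.
by move: cP; rewrite mem_iota szt'.
Qed.

Lemma cliques_rcons k t c p :
  cliques k (rcons t (c, p)) = add_node k (cliques k t) ((size t).+1, c).
Proof.
rewrite /cliques /unzip1 size_rcons map_rcons -[(size t).+1]addn1 iotaD.
rewrite -cats1 zip_cat.
  by rewrite foldl_cat add1n addn1.
by rewrite size_iota size_map.
Qed.

Lemma size_cliques k t : size (cliques k t) = 1 + k * size t.
Proof.
elim/last_ind: t => [|t [c p] IHt]; first by rewrite muln0.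
by rewrite cliques_rcons size_cat IHt size_map size_iota size_rcons /=; lia.
Qed.

Lemma size_drop_at (T : Type) w (s : seq T) :
  w < size s -> size (drop_at w s) = (size s).-1.
Proof.
by move=> lt_ws; rewrite size_cat size_drop size_take lt_ws; lia.
Qed.

Lemma mem_drop_at (T : eqType) w (s : seq T) x : x \in drop_at w s -> x \in s.
Proof. by rewrite mem_cat => /orP [/mem_take | /mem_drop]. Qed.

Lemma count_drop_at (T : Type) (a : pred T) x0 w (s : seq T) :
  w < size s -> count a (drop_at w s) + a (nth x0 s w) = count a s.
Proof.
move=> lt_ws; rewrite -[in RHS](cat_take_drop w s) (drop_nth x0) //.
by rewrite !count_cat /=; lia.
Qed.

(* The value 0 is repeated in the root clique, hence [0 < v]. *)
Lemma cliqueP k t K : ktree k t -> K \in cliques k t ->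
  [/\ size K = k, {in K, forall v, v <= size t} &
      forall v, 0 < v -> count_mem v K <= 1].
Proof.
move=> kt; elim: kt K => {t} [|t c p kt IHt lt_c] K.
  rewrite inE => /eqP ->; split; first by rewrite size_nseq.
    by move=> v /nseqP [-> _].
  by move=> v v_gt0; rewrite count_nseq /=; case: v v_gt0.
rewrite cliques_rcons size_rcons mem_cat => /orP [/IHt [szK leK cK]|].
  by split=> // v /leK /leqW.
move=> /mapP [w]; rewrite mem_iota /= => lt_wk ->.
have /IHt [szK leK cK] : nth [::] (cliques k t) c \in cliques k t.
  by rewrite mem_nth // size_cliques.
set L := nth _ _ _ in szK leK cK *.
have lt_wL : w < size L by rewrite szK.
split.
- by rewrite /= size_drop_at // szK prednK //; apply: leq_ltn_trans lt_wk.
- by move=> v; rewrite inE => /orP [/eqP -> //|/mem_drop_at /leK /leqW].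
- move=> v v_gt0 /=; have := cK v v_gt0.
  rewrite -(count_drop_at _ (pred1 v) 0 _ _ lt_wL).
  case: eqP => [<-|_]; last exact: leq_trans (leq_addr _ _).
  suff /count_memPn -> : (size t).+1 \notin drop_at w L by [].
  by apply/negP => /mem_drop_at /leK; rewrite ltnn.
Qed.

(** If [u] lies in [K], it does so at a single index, and only dropping that index loses it: [k - 1]
    of the [k] cliques keep [u]. The additive form avoids truncated subtraction. *)
Lemma count_mem_drop_at k (K : seq nat) u :
    size K = k -> count_mem u K <= 1 ->
  count (fun w => u \in drop_at w K) (iota 0 k) + (u \in K) = k * (u \in K).
Proof.
move=> szK cK.
have memE s : count_mem u s <= 1 -> (u \in s) = count_mem u s :> nat.
  by rewrite -has_pred1 has_count; case: count => [|[]].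
(* The added term becomes the number of [w] with [u] at index [w], so that the identity holds for
   each [w] separately. *)
have {1}-> : (u \in K) = count (fun w => nth 0 K w == u) (iota 0 k) :> nat.
  rewrite memE // -[in LHS](mkseq_nth 0 K) /mkseq count_map szK.
  by apply: eq_count => w.
rewrite !count_sum -big_split /=.
rewrite (eq_big_seq (fun _ => (u \in K : nat))); last first.
  move=> w; rewrite mem_iota /= -szK => lt_wK.
  have := count_drop_at _ (pred1 u) 0 _ _ lt_wK => /= eqK.
  by rewrite (memE K) // -eqK memE //; apply: leq_trans cK; rewrite -eqK leq_addr.
by rewrite big_const_seq count_predT size_iota iter_addn_0 mulnC.
Qed.

Lemma ktree_lt k t x : ktree k t -> x \in t -> x.1 < 1 + k * size t.
Proof.
move=> kt; elim: kt => {t} [|t c p kt IHt lt_c] //.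
rewrite mem_rcons inE size_rcons => /orP [/eqP -> /=|/IHt]; lia.
Qed.

Lemma outdegE k t u :
  outdeg k t u = count (fun x => u \in nth [::] (cliques k t) x.1) t.
Proof.
rewrite /outdeg -[X in _ = count _ X](mkseq_nth (0, 0) t) /mkseq.
(* Labels start at 1 and indices at 0; the shift cancels the predecessor in [parents]. *)
by rewrite -[1]addn0 iotaDl !count_map.
Qed.

Lemma outdeg_rcons k t c p u : ktree k t -> c < 1 + k * size t ->
  u <= size t ->
  outdeg k (rcons t (c, p)) u = outdeg k t u + (u \in nth [::] (cliques k t) c).
Proof.
move=> kt lt_c le_u; rewrite !outdegE -cats1 count_cat /= addn0.
rewrite cats1 cliques_rcons nth_cat size_cliques lt_c; congr addn.
apply: eq_in_count => x /(ktree_lt _ _ _ kt) lt_x.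
by rewrite nth_cat size_cliques lt_x.
Qed.

(** Every attachment, the last included, is to a clique older than the new node, whose labels are at
    most [size t]. *)
Lemma outdeg_new k t c p : ktree k t -> c < 1 + k * size t ->
  outdeg k (rcons t (c, p)) (size t).+1 = 0.
Proof.
move=> kt lt_c; rewrite outdegE cliques_rcons.
apply/eqP; rewrite -leqn0 leqNgt -has_count; apply/hasPn => x.
rewrite mem_rcons inE => x_in.
have lt_x : x.1 < 1 + k * size t.
  by case/orP: x_in => [/eqP -> //|]; apply: ktree_lt.
rewrite nth_cat size_cliques lt_x.
have /(cliqueP _ _ _ kt) [_ leK _] : nth [::] (cliques k t) x.1 \in cliques k t.
  by rewrite mem_nth // size_cliques.
by apply/negP => /leK; rewrite ltnn.
Qed.

(** A node is born in [k] cliques, and each child adds [k - 1]: of the child's [k] cliques, exactly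
    one omits [u]. *)
Lemma count_cliques k t u : ktree k t -> 0 < u <= size t ->
  count (fun K => u \in K) (cliques k t) + outdeg k t u = k + k * outdeg k t u.
Proof.
move=> kt; elim: kt u => {t} [|t c p kt IHt lt_c] u; first by case: u.
rewrite size_rcons => /andP [u_gt0 le_u].
have K_in : nth [::] (cliques k t) c \in cliques k t.
  by rewrite mem_nth // size_cliques.
have [szK leK cK] := cliqueP _ _ _ kt K_in.
rewrite cliques_rcons count_cat count_map /=.
(* The new node lies in its own [k] cliques and in no older one; for an older node the induction
   hypothesis applies. *)
case: (ltnP (size t) u) => [lt_u|{}le_u].
  have -> : u = (size t).+1 by lia.
  rewrite outdeg_new // muln0 !addn0.
  have -> : count (fun K => (size t).+1 \in K) (cliques k t) = 0.
    apply/eqP; rewrite -leqn0 leqNgt -has_count; apply/hasPn => L.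
    by move=> /(cliqueP _ _ _ kt) [_ leL _]; apply/negP => /leL; rewrite ltnn.
  rewrite add0n (eq_count (a2 := predT)) ?count_predT ?size_iota // => w /=.
  by rewrite inE eqxx.
rewrite outdeg_rcons //.
have := IHt u; rewrite u_gt0 le_u => /(_ isT) IH.
have := count_mem_drop_at _ _ _ szK (cK u u_gt0).
rewrite (eq_count (a1 := preim _ _)
  (a2 := fun w => u \in drop_at w (nth [::] (cliques k t) c))).
  by move=> eqK; rewrite mulnDr [RHS]addnA -IH -eqK addnACA.
by move=> w /=; rewrite inE; case: eqP => // eq_u; lia.
Qed.

(** * Counting insertions, and the recurrence for [count_outdeg] *)

Lemma sum_nchildren k t (a : pred nat) : ktree k t ->
  \sum_(c <- iota 0 (1 + k * size t) | a c) (nchildren t c).+1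
    = count a (iota 0 (1 + k * size t)) + count (fun x => a x.1) t.
Proof.
move=> kt; have Ur := iota_uniq 0 (1 + k * size t).
have mem_r c : (c \in iota 0 (1 + k * size t)) = (c < 1 + k * size t).
  by rewrite mem_iota.
set r := iota _ _ in Ur mem_r *.
under eq_bigr => c _ do rewrite -add1n.
rewrite big_split /= sum1_count; congr addn.
rewrite /nchildren.
under eq_bigr => c _ do rewrite count_sum.
(* After the exchange, each inserted node is counted once, at the clique it is attached to. *)
rewrite exchange_big count_sum /=.
apply: eq_big_seq => x /(ktree_lt _ _ _ kt) lt_x.
rewrite big_mkcond (bigD1_seq x.1) ?mem_r //= eqxx.
rewrite big1 ?addn0 => [|c /negbTE]; first by case: (a _).
by rewrite eq_sym => ->; case: (a c).
Qed.

Lemma sum_weights k t : ktree k t ->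
  \sum_(c <- iota 0 (1 + k * size t)) (nchildren t c).+1
    = 1 + k.+1 * size t.
Proof.
move=> kt; rewrite (sum_nchildren _ _ predT) // !count_predT size_iota; lia.
Qed.

(** The cliques containing [u] number [k + (k - 1) d], and their children are the [d] children of
    [u]. *)
Lemma sum_weights_node k t u : ktree k t -> 0 < u <= size t ->
  \sum_(c <- iota 0 (1 + k * size t) | u \in nth [::] (cliques k t) c)
     (nchildren t c).+1 = k * (outdeg k t u).+1.
Proof.
move=> kt u_le; rewrite (sum_nchildren _ _ (fun c => u \in nth [::] _ c)) //.
rewrite mulnS -count_cliques // outdegE; congr addn.
rewrite -[in RHS](mkseq_nth [::] (cliques k t)) /mkseq count_map size_cliques.
exact: eq_count.
Qed.

Lemma sum_trees_rec k n (F : seq (nat * nat) -> nat) :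
  \sum_(t <- trees k n.+1) F t =
  \sum_(t <- trees k n) \sum_(c <- iota 0 (1 + k * n))
    \sum_(p <- iota 0 (nchildren t c).+1) F (rcons t (c, p)).
Proof.
rewrite treesS big_flatten big_map; apply: eq_bigr => t _.
rewrite big_flatten big_map; apply: eq_bigr => c _.
by rewrite big_map.
Qed.

Lemma size_trees_rec k n :
  size (trees k n.+1) = (1 + k.+1 * n) * size (trees k n).
Proof.
rewrite -!sum1_size sum_trees_rec big_distrr.
apply: eq_big_seq => t /mem_trees [kt szt].
under eq_bigr => c _ do rewrite sum1_size size_iota.
by rewrite -szt sum_weights //=; apply/esym/muln1.
Qed.

Lemma count_outdegE k n m :
  count_outdeg k n m =
    \sum_(t <- trees k n) count (fun u => outdeg k t u == m) (iota 1 n).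
Proof. by rewrite /count_outdeg sumnE big_map. Qed.

Lemma count_outdeg_rcons k t c p m : ktree k t -> c < 1 + k * size t ->
  count (fun u => outdeg k (rcons t (c, p)) u == m) (iota 1 (size t).+1)
  = \sum_(u <- iota 1 (size t))
      (outdeg k t u + (u \in nth [::] (cliques k t) c) == m) + (m == 0).
Proof.
move=> kt lt_c; rewrite -[(size t).+1]addn1 iotaD count_cat add1n.
congr addn; last by rewrite /= outdeg_new // addn0 eq_sym.
rewrite count_sum; apply: eq_big_seq => u.
by rewrite mem_iota => /andP [_ le_u]; rewrite outdeg_rcons.
Qed.

(** An insertion either raises [d] by one, in [k (d + 1)] cases, or leaves it unchanged. The
    subtracted cases stand on the left to stay in [nat]. *)
Lemma sum_insertions_node k t u m : ktree k t -> 0 < u <= size t ->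
  let d := outdeg k t u in
  \sum_(c <- iota 0 (1 + k * size t))
     (nchildren t c).+1 * (d + (u \in nth [::] (cliques k t) c) == m)
   + (d == m) * (k * d.+1)
  = (d == m) * (1 + k.+1 * size t) + (d.+1 == m) * (k * d.+1).
Proof.
move=> kt u_le d; rewrite -sum_weights // -(sum_weights_node _ _ _ kt u_le).
set r := iota _ _; rewrite !big_distrr /=.
rewrite [X in _ + X = _]big_mkcond [X in _ = _ + X]big_mkcond /=.
rewrite -!big_split /=; apply: eq_bigr => c _.
by case: (u \in _); rewrite ?addn1 ?addn0 ?muln0 ?addn0; lia.
Qed.

Lemma count_outdeg_rec k n m :
  count_outdeg k n.+1 m + k * m.+1 * count_outdeg k n m
  = (1 + k.+1 * n) * count_outdeg k n m + k * m * count_outdeg k n m.-1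
    + (m == 0) * size (trees k n.+1).
Proof.
rewrite size_trees_rec !count_outdegE sum_trees_rec -[size _]sum1_size.
rewrite mulnCA !big_distrr -!big_split.
apply: eq_big_seq => t /mem_trees [kt <-].
have -> : \sum_(c <- iota 0 (1 + k * size t))
    \sum_(p <- iota 0 (nchildren t c).+1)
      count (fun u => outdeg k (rcons t (c, p)) u == m) (iota 1 (size t).+1)
  = \sum_(u <- iota 1 (size t)) \sum_(c <- iota 0 (1 + k * size t))
      (nchildren t c).+1 * (outdeg k t u + (u \in nth [::] (cliques k t) c) == m)
    + (1 + k.+1 * size t) * (m == 0).
  (* The out-degrees do not depend on the position [p], so the sum over [p] is a factor; the new
     node accounts for [m == 0]. *)
  rewrite exchange_big -sum_weights // big_distrl -big_split.
  apply: eq_big_seq => c; rewrite mem_iota => lt_c.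
  under eq_bigr => p _ do rewrite count_outdeg_rcons //.
  rewrite big_const_seq count_predT size_iota iter_addn_0 mulnC mulnDr.
  by rewrite big_distrr.
rewrite !count_sum; set r := iota 0 _.
rewrite /= muln1 addnAC !big_distrr -!big_split /=; congr addn.
apply: eq_big_seq => u; rewrite mem_iota add1n ltnS => u_le.
have := sum_insertions_node k t u m kt u_le; rewrite -/r /=.
set A := \sum_(c <- r) _; set W := 1 + _.
move: (outdeg k t u) A => d A; rewrite mulnC [(_ == _) * W]mulnC => eqA.
(* The indicators allow coefficients in [m] to be written in [d]. At [m = 0], where [m.-1] is also
   0, the factor [m] removes the spurious term. *)
have -> : k * m.+1 * (d == m) = k * d.+1 * (d == m).
  by case: eqP => [->|]; rewrite ?muln0.
have -> : k * m * (d == m.-1) = k * d.+1 * (d.+1 == m).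
  case: m {eqA} => [|m]; rewrite ?muln0 // eqSS.
  by case: eqP => [->|]; rewrite ?muln0.
by rewrite eqA [RHS]addnC [LHS]addnC; congr addn; apply: mulnC.
Qed.

(** * Rising factorials and the alternating binomial transform *)

Local Open Scope R_scope.

Lemma INR_addn a b : INR (a + b)%N = INR a + INR b.
Proof. exact: plus_INR. Qed.

Lemma INR_muln a b : INR (a * b)%N = INR a * INR b.
Proof. exact: mult_INR. Qed.

Lemma falling_front x n : falling x n.+1 = x * falling (x - 1) n.
Proof.
elim: n => [|n IHn]; first by rewrite /=; ring.
by rewrite -[LHS]/(falling x n.+1 * (x - INR n.+1)) IHn S_INR /=; ring.
Qed.

Lemma risingS x n : rising x n.+1 = rising x n * (x + INR n).
Proof. by []. Qed.

Lemma rising_front x n : rising x n.+1 = x * rising (x + 1) n.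
Proof.
elim: n => [|n IHn]; first by rewrite /=; ring.
by rewrite risingS IHn S_INR /=; ring.
Qed.

(** The binomials at hand have a top that moves with [n]; as rising factorials their base is fixed,
    and they gain one factor per step. *)
Lemma falling_rising y n : falling (INR n + y) n = rising (y + 1) n.
Proof.
elim: n => [//|n IHn].
rewrite falling_front S_INR /= -IHn.
have -> : INR n + 1 + y - 1 = INR n + y by ring.
by ring.
Qed.

Lemma gbinom_rising y n :
  gbinom (INR n + y) n = rising (y + 1) n / INR (Factorial.fact n).
Proof. by rewrite /gbinom falling_rising. Qed.

Lemma rising_gt0 x n : 0 < x -> 0 < rising x n.
Proof.
move=> x_gt0; elim: n => [|n IHn] /=; first lra.
by have := pos_INR n => ?; apply: Rmult_lt_0_compat; lra.
Qed.

Lemma INR_fact_gt0 n : 0 < INR (Factorial.fact n).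
Proof. exact: INR_fact_lt_0. Qed.

(** The alternating binomial transform (see [fdiffE]), defined through Pascal's rule so that its
    properties follow by induction on [m]. *)
Fixpoint fdiff (m : nat) (f : nat -> R) : R :=
  if m is m'.+1 then fdiff m' f - fdiff m' (fun l => f l.+1) else f O.

Lemma fdiffS m f : fdiff m.+1 f = fdiff m f - fdiff m (fun l => f l.+1).
Proof. by []. Qed.

Lemma eq_fdiff m f g : (forall l, f l = g l) -> fdiff m f = fdiff m g.
Proof.
elim: m f g => [|m IHm] f g eq_fg /=; first exact: eq_fg.
by rewrite (IHm f g) // (IHm (fun l => f l.+1) (fun l => g l.+1)).
Qed.

Lemma fdiffD m f g : fdiff m (fun l => f l + g l) = fdiff m f + fdiff m g.
Proof. by elim: m f g => [|m IHm] f g //=; rewrite !IHm; ring. Qed.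

Lemma fdiffZ m a f : fdiff m (fun l => a * f l) = a * fdiff m f.
Proof. by elim: m f => [|m IHm] f //=; rewrite !IHm; ring. Qed.

Lemma fdiff_const m a : fdiff m (fun=> a) = if m is O then a else 0.
Proof. by elim: m => [|m IHm] //=; ring. Qed.

(** This is what diagonalises the recurrence: its operator in [m] acts on the [l]-th mode as
    multiplication by [l + 1]. *)
Lemma fdiff_mul m f :
  fdiff m (fun l => (INR l + 1) * f l)
  = (INR m + 1) * fdiff m f - INR m * fdiff m.-1 f.
Proof.
elim: m f => [|m IHm] f; first by rewrite /=; ring.
rewrite !fdiffS IHm.
rewrite (eq_fdiff _ (fun l => (INR l.+1 + 1) * f l.+1)
                   (fun l => (INR l + 1) * f l.+1 + f l.+1)); last first.
  by move=> l; rewrite S_INR; ring.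
rewrite fdiffD (IHm (fun l => f l.+1)) S_INR.
by case: m {IHm} => [|m]; rewrite ?fdiffS ?S_INR /=; ring.
Qed.

Lemma fdiffE m f :
  sum_f_R0 (fun l => INR 'C(m, l) * (-1) ^ l * f l) m = fdiff m f.
Proof.
elim: m f => [|m IHm] f; first by rewrite /=; ring.
rewrite fdiffS -!IHm.
(* Adding the zero term at [l = m + 1] aligns this sum with the shifted one for Pascal's rule. *)
have -> : sum_f_R0 (fun l => INR 'C(m, l) * (-1) ^ l * f l) m
        = sum_f_R0 (fun l => INR 'C(m, l) * (-1) ^ l * f l) m.+1.
  by rewrite tech5 bin_small // [INR O]/=; ring.
rewrite !(decomp_sum _ m.+1); try exact: Nat.lt_0_succ.
rewrite [Nat.pred m.+1]/= !bin0 /Rminus Rplus_assoc; congr Rplus.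
rewrite -[- sum_f_R0 _ _]Rmult_1_l -Ropp_mult_distr_r Ropp_mult_distr_l.
rewrite scal_sum -plus_sum.
apply: PartSum.sum_eq => l _.
by rewrite binS INR_addn /=; ring.
Qed.

(** A partial fraction expansion. Shifting [l] replaces [x] by [x + 1], and the difference of the
    two quotients has numerator [m! ((x + m + 1) - x)]. *)
Lemma fdiff_inv m x : 0 < x ->
  fdiff m (fun l => / (INR l + x)) = INR (Factorial.fact m) / rising x m.+1.
Proof.
elim: m x => [|m IHm] x x_gt0; first by rewrite /=; field; lra.
rewrite fdiffS.
rewrite (eq_fdiff _ (fun l => / (INR l.+1 + x))
                   (fun l => / (INR l + (x + 1)))); last first.
  by move=> l; rewrite S_INR; congr Rinv; ring.
rewrite !IHm; [|lra|lra].
have r_gt0 : 0 < rising (x + 1) m by apply: rising_gt0; lra.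
rewrite [in RHS]rising_front [rising x m.+1]rising_front.
rewrite [rising (x + 1) m.+1]risingS.
rewrite fact_simpl mult_INR S_INR.
by have := pos_INR m => ?; field; lra.
Qed.

(** * Limits of sequences *)

Lemma fdiff_cv m (u : nat -> nat -> R) (v : nat -> R) :
  (forall l, Un_cv (fun n => u n l) (v l)) ->
  Un_cv (fun n => fdiff m (u n)) (fdiff m v).
Proof.
elim: m u v => [|m IHm] u v cv_uv; first exact: cv_uv.
apply: (CV_minus (fun n => fdiff m (u n)) (fun n => fdiff m (fun l => u n l.+1))).
  exact: IHm.
by apply: (IHm (fun n l => u n l.+1)).
Qed.

Lemma Un_cv_eventually u v l n0 :
  (forall n, (n0 <= n)%N -> u n = v n) -> Un_cv u l -> Un_cv v l.
Proof.
move=> eq_uv cv_u eps /cv_u [N NP]; exists (maxn n0 N) => n le_n.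
by rewrite -eq_uv; [apply: NP|]; lia.
Qed.

Lemma CV_const a : Un_cv (fun=> a) a.
Proof. by move=> eps eps_gt0; exists O => n _; rewrite R_dist_eq. Qed.

Lemma cv_div_INR C : Un_cv (fun n => C / INR n) 0.
Proof.
move=> eps eps_gt0.
have [N NP] := INR_unbounded (Rabs C / eps).
exists N.+1 => n le_n.
have n_gt : INR N < INR n by apply: lt_INR; lia.
have n_gt0 : 0 < INR n by have := pos_INR N; lra.
rewrite /R_dist Rminus_0_r /Rdiv Rabs_mult Rabs_inv (Rabs_pos_eq (INR n)); last lra.
apply: (Rmult_lt_reg_r (INR n)) => //.
rewrite Rmult_assoc Rinv_l; last lra.
have -> : Rabs C * 1 = Rabs C / eps * eps by field; lra.
by rewrite [eps * _]Rmult_comm; apply: Rmult_lt_compat_r; lra.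
Qed.

Lemma Un_cv_squeeze0 u C n0 :
  (forall n, (n0 <= n)%N -> Rabs (u n) <= C / INR n) -> Un_cv u 0.
Proof.
move=> le_u eps /(cv_div_INR C) [N NP]; exists (maxn n0 N) => n le_n.
have := NP n; have := le_u n; rewrite /R_dist !Rminus_0_r.
move=> /(_ ltac:(lia)) le1 /(_ ltac:(lia)) lt2.
by have := Rle_abs (C / INR n); lra.
Qed.

(** Beyond an [n0 > - z] the factors satisfy [0 <= z + i <= r + i], so the absolute ratio of the
    rising factorials stays below its value [C] at [n0]; the factor [1 / n] does the rest. *)
Lemma rising_ratio_cv z r : 0 < r -> z <= r ->
  Un_cv (fun n => rising z n / (INR n * rising r n)) 0.
Proof.
move=> r_gt0 le_zr.
have [n0 n0P] := INR_unbounded (- z).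
have r_pos n := rising_gt0 r n r_gt0.
set C := Rabs (rising z n0) / rising r n0.
have ratio_le d : Rabs (rising z (d + n0)) <= C * rising r (d + n0).
  elim: d => [|d IHd].
    by rewrite add0n /C; right; field; have := r_pos n0; lra.
  rewrite addSn /= Rabs_mult -Rmult_assoc.
  have := pos_INR d => d_ge0; rewrite INR_addn.
  apply: Rmult_le_compat => //; try exact: Rabs_pos.
  by rewrite Rabs_pos_eq; lra.
apply: (Un_cv_squeeze0 _ C n0.+1) => n le_n.
have n_gt0 : 0 < INR n by apply: lt_0_INR; lia.
have := ratio_le (n - n0)%N; rewrite subnK; last exact: ltnW.
have rn := r_pos n.
rewrite /Rdiv Rabs_mult Rabs_inv (Rabs_pos_eq (INR n * _)); last nra.
move=> le_z; apply: (Rmult_le_reg_r (INR n * rising r n)); first nra.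
have -> : Rabs (rising z n) * / (INR n * rising r n) * (INR n * rising r n)
  = Rabs (rising z n) by field; split; lra.
by have -> : C * / INR n * (INR n * rising r n) = C * rising r n by field; lra.
Qed.

(** At [x = 2] this is an equality. *)
Lemma rising_ge_fact x n : 2 <= x -> INR (Factorial.fact n.+1) <= rising x n.
Proof.
move=> x_ge2; elim: n => [|n IHn]; first by rewrite /=; lra.
rewrite fact_simpl mult_INR Rmult_comm [rising _ _]/=.
have := pos_INR n => n_ge0; have := INR_fact_gt0 n.+1 => f_gt0.
by apply: Rmult_le_compat; rewrite ?S_INR; lra.
Qed.

(** * The limit law and its total mass *)

Lemma INR_gt0 k : (0 < k)%N -> 0 < INR k.
Proof. by move=> k_gt0; apply: lt_0_INR; lia. Qed.

Lemma shape_gt2 k : (0 < k)%N -> 2 < 2 + 1 / INR k.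
Proof. by move=> /INR_gt0 /(Rdiv_lt_0_compat 1 _ Rlt_0_1); lra. Qed.

Lemma p_limE k m : (0 < k)%N ->
  p_lim k m = (INR k + 1) / INR k *
              (INR (Factorial.fact m) / rising (2 + 1 / INR k) m.+1).
Proof.
move=> k_gt0; have K_gt0 := INR_gt0 k k_gt0.
have := shape_gt2 k k_gt0; set x := 2 + 1 / INR k => x_gt2.
have r_gt0 : 0 < rising x m.+1 by apply: rising_gt0; lra.
have f_gt0 := INR_fact_gt0 m; have m_ge0 := pos_INR m.
rewrite /p_lim addn1.
have -> : INR m + 2 + 1 / INR k = INR m.+1 + (1 + 1 / INR k).
  by rewrite S_INR; ring.
rewrite gbinom_rising fact_simpl mult_INR S_INR.
have -> : 1 + 1 / INR k + 1 = x by rewrite /x; ring.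
by field; lra.
Qed.

(** With [x = 2 + 1/k] one has [(k + 1)/k = x - 1 = (x + m) - (m + 1)], so [p_m] is the difference
    of [m! / rising x m] and its successor. *)
Lemma sum_p_lim k n : (0 < k)%N ->
  sum_f_R0 (p_lim k) n =
    1 - INR (Factorial.fact n.+1) / rising (2 + 1 / INR k) n.+1.
Proof.
move=> k_gt0; have K_gt0 := INR_gt0 k k_gt0.
have := shape_gt2 k k_gt0; set x := 2 + 1 / INR k => x_gt2.
have xE : x = 2 + / INR k by rewrite /x; field; lra.
have iK : 0 < / INR k by apply: Rinv_0_lt_compat.
elim: n => [|n IHn].
  by rewrite /sum_f_R0 p_limE // -/x xE /=; field; lra.
rewrite tech5 IHn p_limE // -/x.
have r_gt0 : 0 < rising x n.+1 by apply: rising_gt0; lra.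
rewrite [rising x n.+2]risingS.
rewrite [Factorial.fact n.+2]fact_simpl mult_INR.
have n_ge0 := pos_INR n; rewrite !S_INR.
have -> : (INR k + 1) / INR k = x - 1 by rewrite /x; field; lra.
by field; lra.
Qed.

Lemma sum_p_lim_cv k : (0 < k)%N -> infinite_sum (p_lim k) 1.
Proof.
move=> k_gt0; have := shape_gt2 k k_gt0; set x := 2 + 1 / INR k => x_gt2.
have cv0 : Un_cv (fun n => INR (Factorial.fact n.+1) / rising x n.+1) 0.
  apply: (Un_cv_squeeze0 _ 1 1) => n le_n.
  have n_gt0 : 0 < INR n by apply: lt_0_INR; lia.
  have r_gt0 : 0 < rising x n.+1 by apply: rising_gt0; lra.
  have f_gt0 := INR_fact_gt0 n.+1.
  (* The denominator is at least [(n + 2)!], hence at least [n (n + 1)!], and the remainder is at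
     most [1 / n]. *)
  have := rising_ge_fact x n.+1 (Rlt_le _ _ x_gt2).
  rewrite fact_simpl mult_INR !S_INR => le_r.
  rewrite Rabs_pos_eq; last by apply: Rlt_le; apply: Rdiv_lt_0_compat.
  apply: (Rmult_le_reg_r (INR n * rising x n.+1)); first nra.
  have -> : INR (Factorial.fact n.+1) / rising x n.+1 * (INR n * rising x n.+1)
    = INR (Factorial.fact n.+1) * INR n by field; lra.
  have -> : 1 / INR n * (INR n * rising x n.+1) = rising x n.+1 by field; lra.
  by nra.
move=> eps /cv0 [N NP]; exists N => n /NP; rewrite /R_dist sum_p_lim // -/x.
move: (INR _ / _) => y; rewrite -Rabs_Ropp.
by have -> : - (y - 0) = 1 - y - 1 by ring.
Qed.

(** * Existence and positivity of Gauss's limit for Gamma *)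

Lemma exp_le_mono a b : a <= b -> exp a <= exp b.
Proof.
by case=> [lt_ab | ->]; [apply/Rlt_le/exp_increasing | apply: Rle_refl].
Qed.

Lemma ln_le_sub1 y : 0 < y -> ln y <= y - 1.
Proof.
move=> y_gt0; have := exp_ineq1_le (ln y); rewrite exp_ln //; lra.
Qed.

Lemma ln_ge_1subV y : 0 < y -> 1 - / y <= ln y.
Proof.
move=> y_gt0; have := ln_le_sub1 (/ y) (Rinv_0_lt_compat _ y_gt0).
by rewrite ln_Rinv //; lra.
Qed.

Lemma Rpower_gt0 y z : 0 < Rpower y z.
Proof. exact: exp_pos. Qed.

Definition gauss (x : R) (n : nat) : R :=
  INR (Factorial.fact n) * Rpower (INR n) x / rising x n.+1.

(* The shift of the base makes [gauss_up x] decreasing, so that it bounds the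
   increasing [gauss x]. *)
Definition gauss_up (x : R) (n : nat) : R :=
  INR (Factorial.fact n) * Rpower (INR n + x + 1) x / rising x n.+1.

Lemma Rpower_ratio a b x : 0 < a -> 0 < b ->
  Rpower b x = Rpower a x * exp (x * ln (b / a)).
Proof.
move=> a_gt0 b_gt0; rewrite /Rpower -exp_plus /Rdiv ln_mult //; last first.
  exact: Rinv_0_lt_compat.
by rewrite ln_Rinv //; congr exp; ring.
Qed.

Lemma gauss_gt0 x n : 0 < x -> 0 < gauss x n.
Proof.
move=> x_gt0; apply: Rdiv_lt_0_compat; last exact: rising_gt0.
by apply: Rmult_lt_0_compat; [apply: INR_fact_gt0 | apply: Rpower_gt0].
Qed.

(** The claim reduces to [1 + x/(N+1) <= (1 + 1/N)^x]; in logarithms, [x/(N+1)] separates the two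
    sides. Indices start at 1 so that [ln N] is not a default value. *)
Lemma gauss_mono x n : 0 < x -> gauss x n.+1 <= gauss x n.+2.
Proof.
move=> x_gt0; rewrite /gauss [rising x n.+3]risingS.
rewrite [Factorial.fact n.+2]fact_simpl mult_INR.
have N_gt0 : 0 < INR n.+1 by apply: lt_0_INR; lia.
have f_gt0 := INR_fact_gt0 n.+1; have r_gt0 := rising_gt0 x n.+2 x_gt0.
rewrite [INR n.+2]S_INR; move: N_gt0 f_gt0.
move: (INR n.+1) (INR (Factorial.fact n.+1)) => N F N_gt0 f_gt0.
rewrite (Rpower_ratio N (N + 1)) //; last lra.
set e := exp _.
have e_ge : (x + (N + 1)) / (N + 1) <= e.
  have -> : (x + (N + 1)) / (N + 1) = exp (ln ((x + (N + 1)) / (N + 1))).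
    by rewrite exp_ln //; apply: Rdiv_lt_0_compat; lra.
  apply: exp_le_mono.
  have y_gt0 : 0 < (x + (N + 1)) / (N + 1) by apply: Rdiv_lt_0_compat; lra.
  have := ln_le_sub1 _ y_gt0.
  have z_gt0 : 0 < (N + 1) / N by apply: Rdiv_lt_0_compat; lra.
  have := ln_ge_1subV _ z_gt0.
  have -> : 1 - / ((N + 1) / N) = / (N + 1) by field; lra.
  have -> : (x + (N + 1)) / (N + 1) - 1 = x * / (N + 1) by field; lra.
  move=> le1 le2; apply: Rle_trans le2 _.
  by apply: Rmult_le_compat_l; lra.
have P_gt0 := Rpower_gt0 N x.
have -> : (N + 1) * F * (Rpower N x * e) / (rising x n.+2 * (x + (N + 1)))
  = F * Rpower N x / rising x n.+2 * ((N + 1) * e / (x + (N + 1))) by field; lra.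
rewrite -[X in X <= _]Rmult_1_r; apply: Rmult_le_compat_l.
  by apply: Rlt_le; apply: Rdiv_lt_0_compat => //; nra.
apply: (Rmult_le_reg_r (x + (N + 1))); first lra.
have -> : (N + 1) * e / (x + (N + 1)) * (x + (N + 1)) = e * (N + 1) by field; lra.
have -> : 1 * (x + (N + 1)) = (x + (N + 1)) / (N + 1) * (N + 1) by field; lra.
by apply: Rmult_le_compat_r; lra.
Qed.

(** Here [(1 + 1/(N+x+1))^x <= 1 + x/(N+1)] is needed; the shift [x + 1] is chosen so that both
    logarithmic bounds equal [x/(N+x+1)]. *)
Lemma gauss_up_mono x n : 0 < x -> gauss_up x n.+1 <= gauss_up x n.
Proof.
move=> x_gt0; rewrite /gauss_up [rising x n.+2]risingS fact_simpl mult_INR S_INR.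
have N_ge0 := pos_INR n.
have f_gt0 := INR_fact_gt0 n; have r_gt0 := rising_gt0 x n.+1 x_gt0.
move: (INR n) (INR (Factorial.fact n)) N_ge0 f_gt0 => N F N_ge0 f_gt0.
rewrite (Rpower_ratio (N + x + 1) (N + 1 + x + 1)); try lra.
set e := exp _.
have e_le : e <= (x + (N + 1)) / (N + 1).
  have y_gt0 : 0 < (x + (N + 1)) / (N + 1) by apply: Rdiv_lt_0_compat; lra.
  rewrite -(exp_ln _ y_gt0); apply: exp_le_mono.
  have := ln_ge_1subV _ y_gt0.
  have z_gt0 : 0 < (N + 1 + x + 1) / (N + x + 1) by apply: Rdiv_lt_0_compat; lra.
  have := ln_le_sub1 _ z_gt0.
  have -> : 1 - / ((x + (N + 1)) / (N + 1)) = x * / (N + x + 1) by field; lra.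
  have -> : (N + 1 + x + 1) / (N + x + 1) - 1 = / (N + x + 1) by field; lra.
  move=> le1; apply: Rle_trans.
  by apply: Rmult_le_compat_l; lra.
have P_gt0 := Rpower_gt0 (N + x + 1) x.
have -> : (N + 1) * F * (Rpower (N + x + 1) x * e) / (rising x n.+1 * (x + (N + 1)))
  = F * Rpower (N + x + 1) x / rising x n.+1 * ((N + 1) * e / (x + (N + 1))).
  by field; lra.
rewrite -[X in _ <= X]Rmult_1_r; apply: Rmult_le_compat_l.
  by apply: Rlt_le; apply: Rdiv_lt_0_compat => //; nra.
apply: (Rmult_le_reg_r (x + (N + 1))); first lra.
have -> : (N + 1) * e / (x + (N + 1)) * (x + (N + 1)) = e * (N + 1) by field; lra.
have -> : 1 * (x + (N + 1)) = (x + (N + 1)) / (N + 1) * (N + 1) by field; lra.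
by apply: Rmult_le_compat_r; lra.
Qed.

Lemma gauss_le_up x n : 0 < x -> gauss x n.+1 <= gauss_up x 0.
Proof.
move=> x_gt0; apply: (Rle_trans _ (gauss_up x n.+1)); last first.
  elim: n.+1 => [|m IHm]; first lra.
  by apply: Rle_trans IHm; apply: gauss_up_mono.
have N_gt0 : 0 < INR n.+1 by apply: lt_0_INR; lia.
apply: Rmult_le_compat_r.
  by apply: Rlt_le; apply: Rinv_0_lt_compat; apply: rising_gt0.
apply: Rmult_le_compat_l; first exact: Rlt_le (INR_fact_gt0 _).
by apply: Rle_Rpower_l; lra.
Qed.

Lemma Gamma_exists x : 0 < x -> exists G, 0 < G /\ is_Gamma x G.
Proof.
move=> x_gt0.
have grow : Un_growing (fun n => gauss x n.+1) by move=> n; apply: gauss_mono.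
have [|G cvG] := growing_cv _ grow.
  by exists (gauss_up x 0) => _ [n ->]; apply: gauss_le_up.
exists G; split.
  (* An increasing sequence stays below its limit, so the positive term [gauss x 1] bounds [G] from
     below. *)
  apply: Rlt_le_trans (gauss_gt0 x 1 x_gt0) _.
  exact: (growing_ineq _ _ grow cvG O).
apply: (CV_shift _ 1); apply: (Un_cv_eventually _ _ _ 0 _ cvG) => n _.
by rewrite PeanoNat.Nat.add_1_r.
Qed.

(** * Solution of the recurrence, exact distribution and its limit *)

Lemma size_treesE k n :
  INR (size (trees k n)) = (INR k + 1) ^ n * rising (/ (INR k + 1)) n.
Proof.
have K_ge0 := pos_INR k.
elim: n => [|n IHn]; first by rewrite /=; ring.
rewrite size_trees_rec INR_muln IHn INR_addn INR_muln !S_INR risingS [_ ^ n.+1]/=.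
by rewrite [INR 0]/=; field; lra.
Qed.

(* The l-th mode of the recurrence, divided by [(k + 1) ^ n]. *)
Definition outdeg_term (k n l : nat) : R :=
  (rising (1 + / (INR k + 1)) n
   - rising (1 - INR k * (INR l + 2) / (INR k + 1)) n)
  / (INR k * (INR l + 2) + 1).

(** The second rising factorial solves the homogeneous recurrence, since
    [(k+1) - k(l+2) = 1 - k(l+1)]. The first leaves an excess factor [k(l+2) + 1], which the
    denominator normalises to 1. *)
Lemma outdeg_term_rec k n l :
  (INR k + 1) * outdeg_term k n.+1 l
  = (1 + (INR k + 1) * INR n) * outdeg_term k n l
    - INR k * ((INR l + 1) * outdeg_term k n l)
    + rising (1 + / (INR k + 1)) n.
Proof.
have K_ge0 := pos_INR k; have l_ge0 := pos_INR l.
by rewrite /outdeg_term !risingS; field; split; nra.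
Qed.

(** The modes vanish at [n = 0]. Their source term is constant in [l], so its transform is zero
    unless [m = 0], where it matches the contribution of the new node. *)
Lemma count_outdeg_fdiff k n m :
  INR (count_outdeg k n m) = (INR k + 1) ^ n * fdiff m (outdeg_term k n).
Proof.
have K_ge0 := pos_INR k.
elim: n m => [|n IHn] m.
  rewrite (eq_fdiff _ _ (fun=> 0)); last first.
    by move=> l; rewrite /outdeg_term /=; field; have := pos_INR l; nra.
  by rewrite fdiff_const /count_outdeg /=; case: m => [|m] /=; ring.
have := congr1 INR (count_outdeg_rec k n m).
rewrite !INR_addn !INR_muln !IHn !INR_addn !INR_muln size_treesE rising_front.
rewrite S_INR.
set x := / (INR k + 1); rewrite [x + 1]Rplus_comm.
have -> : (INR k + 1) ^ n.+1 * fdiff m (outdeg_term k n.+1)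
  = (INR k + 1) ^ n * fdiff m (fun l => (INR k + 1) * outdeg_term k n.+1 l).
  by rewrite fdiffZ /=; ring.
rewrite (eq_fdiff _ _ _ (outdeg_term_rec k n)) !fdiffD fdiff_const.
rewrite (eq_fdiff _ (fun l => - _)
  (fun l => - INR k * ((INR l + 1) * outdeg_term k n l))); last first.
  by move=> l; ring.
rewrite !fdiffZ fdiff_mul -/x [_ ^ n.+1]/=.
have -> : (INR k + 1) * (INR k + 1) ^ n * (x * rising (1 + x) n)
   = (INR k + 1) ^ n * rising (1 + x) n by rewrite /x; field; lra.
case: m => [|m] /=; first by lra.
by lra.
Qed.

Lemma prob_YbarE k n m :
  prob_Ybar k n m =
    fdiff m (outdeg_term k n) / (INR n * rising (/ (INR k + 1)) n).
Proof.
have K_ge0 := pos_INR k.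
have x_gt0 : 0 < / (INR k + 1) by apply: Rinv_0_lt_compat; lra.
have r_gt0 := rising_gt0 _ n x_gt0.
have P_gt0 : 0 < (INR k + 1) ^ n by apply: pow_lt; lra.
rewrite /prob_Ybar count_outdeg_fdiff size_treesE.
(* [INR n] may be 0, so its inverse is kept abstract; only [(k + 1) ^ n] has to cancel. *)
rewrite /Rdiv !Rinv_mult; move: (/ INR n) (/ rising _ n) => u v.
by field; lra.
Qed.

Lemma exact_formulaE k n m : (0 < n)%N ->
  exact_formula k n m =
    fdiff m (outdeg_term k n) / (INR n * rising (/ (INR k + 1)) n).
Proof.
move=> n_gt0; have K_ge0 := pos_INR k.
have N_gt0 : 0 < INR n by apply: INR_gt0.
have x_gt0 : 0 < / (INR k + 1) by apply: Rinv_0_lt_compat; lra.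
have r_gt0 := rising_gt0 _ n x_gt0; have f_gt0 := INR_fact_gt0 n.
rewrite /exact_formula.
rewrite (_ : sum_f_R0 _ m = fdiff m (outdeg_term k n) / INR (Factorial.fact n)).
  have -> : INR n - INR k / (INR k + 1) = INR n + (- INR k / (INR k + 1)).
    by field; lra.
  rewrite gbinom_rising.
  have -> : - INR k / (INR k + 1) + 1 = / (INR k + 1) by field; lra.
  by field; lra.
rewrite -fdiffE /Rdiv [RHS]Rmult_comm scal_sum; apply: PartSum.sum_eq => l _.
have l_ge0 := pos_INR l.
have -> : INR n - INR k * (INR l + 2) * / (INR k + 1)
   = INR n + (- (INR k * (INR l + 2) / (INR k + 1))) by field; lra.
rewrite !gbinom_rising /outdeg_term.
have -> : - (INR k * (INR l + 2) / (INR k + 1)) + 1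
   = 1 - INR k * (INR l + 2) / (INR k + 1) by ring.
have -> : 1 * / (INR k + 1) + 1 = 1 + / (INR k + 1) by ring.
by field; split; nra.
Qed.

(** With [x = 1/(k+1)], the ratio of [rising (1 + x) n] to [rising x n] is [1 + (k+1) n], which
    gives the limit; the other rising factorial has base [z <= x] and is negligible. *)
Lemma outdeg_term_cv k l :
  Un_cv (fun n => outdeg_term k n l / (INR n * rising (/ (INR k + 1)) n))
        ((INR k + 1) / (INR k * (INR l + 2) + 1)).
Proof.
have K_ge0 := pos_INR k; have l_ge0 := pos_INR l.
set x := / (INR k + 1).
have x_gt0 : 0 < x by apply: Rinv_0_lt_compat; lra.
have xE : (INR k + 1) * x = 1 by rewrite /x; field; lra.
set z := 1 - INR k * (INR l + 2) / (INR k + 1).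
have le_zx : z <= x.
  have -> : z = 1 - INR k * (INR l + 2) * x by rewrite /z /x.
  have Kx_ge0 := Rmult_le_pos _ _ K_ge0 (Rlt_le _ _ x_gt0).
  by have := Rmult_le_pos _ _ l_ge0 Kx_ge0; lra.
set c := INR k * (INR l + 2) + 1.
have c_gt0 : 0 < c by rewrite /c; nra.
have cv := CV_minus _ _ _ _ (cv_div_INR 1) (rising_ratio_cv z x x_gt0 le_zx).
have {}cv := CV_plus _ _ _ _ (CV_const (INR k + 1)) cv.
have {}cv := CV_mult _ _ _ _ (CV_const (/ c)) cv.
have -> : (INR k + 1) / c = / c * (INR k + 1 + (0 - 0)) by field; lra.
apply: (Un_cv_eventually _ _ _ 1 _ cv) => n n_gt0.
have N_gt0 := INR_gt0 n n_gt0; have r_gt0 := rising_gt0 _ n x_gt0.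
rewrite /outdeg_term -/x -/z -/c.
have -> : rising (1 + x) n = (1 + (INR k + 1) * INR n) * rising x n.
  have := rising_front x n; rewrite risingS [1 + x]Rplus_comm => eq_r.
  apply: (Rmult_eq_reg_l x); last lra.
  by rewrite -eq_r /x; field; lra.
by field; lra.
Qed.

Lemma prob_Ybar_cv k m : (0 < k)%N ->
  Un_cv (fun n => prob_Ybar k n m) (p_lim k m).
Proof.
move=> k_gt0; have K_gt0 := INR_gt0 k k_gt0; have x_gt2 := shape_gt2 k k_gt0.
have := fdiff_cv m _ _ (outdeg_term_cv k).
(* Factoring [k] out of [k(l+2) + 1] leaves [l + (2 + 1/k)], the form required by [fdiff_inv]. *)
rewrite (eq_fdiff _ _
  (fun l => (INR k + 1) / INR k * / (INR l + (2 + 1 / INR k)))); last first.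
  move=> l; have := pos_INR l => l_ge0; by field; split; nra.
rewrite fdiffZ fdiff_inv -?p_limE //; last lra.
apply: (Un_cv_eventually _ _ _ 0) => n _; rewrite prob_YbarE.
rewrite /Rdiv [RHS]Rmult_comm -fdiffZ; apply: eq_fdiff => l; ring.
Qed.

Theorem theorem3 (k : nat) (hk : (0 < k)%N) :
  (* exact distribution of Ybar_n *)
  (forall n m : nat, (1 <= n)%N -> prob_Ybar k n m = exact_formula k n m)
  (* convergence in distribution to Ybar with P{Ybar = m} = p_m *)
  /\ (forall m : nat, Un_cv (fun n => prob_Ybar k n m) (p_lim k m))
  /\ infinite_sum (p_lim k) 1
  (* tail asymptotics p_m ~ (k+1)/k Gamma(2+1/k) m^(-2-1/k) *)
  /\ (exists G : R, is_Gamma (2 + 1 / INR k) G /\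
        Un_cv (fun m => p_lim k m /
                  ((INR k + 1) / INR k * G * Rpower (INR m) (- (2 + 1 / INR k))))
              1).
Proof.
split; [|split; [|split]].
- by move=> n m n_gt0; rewrite exact_formulaE // prob_YbarE.
- by move=> m; apply: prob_Ybar_cv.
- exact: sum_p_lim_cv.
have K_gt0 := INR_gt0 k hk; have x_gt2 := shape_gt2 k hk.
have [|G [G_gt0 cvG]] := Gamma_exists (2 + 1 / INR k); first lra.
exists G; split=> //.
(* By [p_limE], the quotient in question is the [m]-th term of Gauss's sequence divided by [G]. *)
have := CV_mult _ _ _ _ (CV_const (/ G)) cvG.
rewrite Rinv_l; last lra.
apply: (Un_cv_eventually _ _ _ 0) => m _.
rewrite p_limE //; move: x_gt2; set x := 2 + _ => x_gt2.
have r_gt0 : 0 < rising x m.+1 by apply: rising_gt0; lra.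
have := Rpower_gt0 (INR m) x => P_gt0.
by rewrite Rpower_Ropp; field; lra.
Qed.
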